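(* Let $p$ be an odd prime, $a\in\mathbb Z_p$ with $a\not\equiv0,-1\pmod p$, and $a'=(a-\langle a\rangle_p)/p$. Then $$\sum_{k=0}^{p-1}\binom ak\binom{-1-a}k\binom{2k}k\frac{k^2}{4^k}\equiv\frac23a^2(a+1)^2S_p(a)-\frac{2a(a+1)-1}3(a+1)^2S_p(a+1)+\frac{(2a^2+a-2)a'(a'+1)}{3(a+1)}p^3\pmod{p^4}.$$
   Context: For a prime $p$, $\mathbb Z_p$ denotes the set of rational numbers whose denominator is not divisible by $p$; for rationals $x,y$ and $m\ge 1$, $x\equiv y\pmod{p^m}$ means $(x-y)/p^m\in\mathbb Z_p$. For $a\in\mathbb Z_p$, $\langle a\rangle_p\in\{0,1,\ldots,p-1\}$ is determined by $a\equiv\langle a\rangle_p\pmod p$. For rational $a$ and integer $k\ge0$, $\binom ak=a(a-1)\cdots(a-k+1)/k!$. Define $S_n(a)=\sum_{k=0}^{n-1}\binom ak\binom{-1-a}k\binom{2k}k\frac1{4^k}$ for $n\ge1$. *)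

(* Defs.v *)
From mathcomp Require Import all_boot all_order all_algebra.
From mathcomp Require Import ring zify.

Set Implicit Arguments.
Unset Strict Implicit.
Unset Printing Implicit Defensive.

Import Order.TTheory GRing.Theory Num.Theory.
Local Open Scope ring_scope.

(* The p-integral rationals: p does not divide the reduced denominator. *)
Definition Zploc (p : nat) : pred rat := [pred x | ~~ (p%:Z %| denq x)%Z].

Definition eqmod_pow (p m : nat) (x y : rat) : bool :=
  (x - y) / p%:R ^+ m \in Zploc p.

(* The r in {0, ..., p - 1} with a = r modulo p; for p prime and a in
   [Zploc p] it exists and is unique, see [residueP] and [residue_uniq].
   (When there is no such r, the value is p.) *)
Definition residue (p : nat) (a : rat) : nat :=
  find (fun r : nat => eqmod_pow p 1 a r%:R) (iota 0 p).

Definition ratbin (a : rat) (k : nat) : rat :=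
  (\prod_(i < k) (a - i%:R)) / k`!%:R.

Definition Ssum (n : nat) (a : rat) : rat :=
  \sum_(k < n) ratbin a k * ratbin (-1 - a) k * 'C(k.*2, k)%:R / 4 ^+ k.

Lemma Zploc_frac (p : nat) (n d : int) :
  ~~ (p%:Z %| d)%Z -> (n%:Q / d%:Q) \in Zploc p.
Proof.
move=> pd; rewrite inE; apply: contra pd => pden.
have d0 : d%:Q != 0 \/ d = 0 by case: (eqVneq d 0) => [->|]; [right|left; rewrite intr_eq0].
case: d0 => [d0|->]; last by rewrite dvdz0.
apply: dvdz_trans pden _.
set x := n%:Q / d%:Q.
have e : numq x * d = n * denq x.
  apply: (@intr_inj rat); rewrite !rmorphM /= numqE /x.
  by field.
have : (denq x %| numq x * d)%Z by rewrite e dvdz_mull.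
by rewrite Gauss_dvdzr // coprimezE coprime_sym coprime_num_den.
Qed.

Lemma residue_has (p : nat) (a : rat) :
  prime p -> a \in Zploc p ->
  has (fun r : nat => eqmod_pow p 1 a r%:R) (iota 0 p).
Proof.
move=> pp; rewrite inE => pa.
have p0 : p%:Z != 0 by rewrite eqz_nat -lt0n prime_gt0.
have cop : coprimez p%:Z (denq a) by rewrite coprimezE prime_coprime.
have [[u v] /= uv] := coprimezP _ _ cop.
pose z := (numq a * v %% p%:Z)%Z.
have z0 : 0 <= z by rewrite modz_ge0.
have zp : z < p%:Z by rewrite ltz_pmod // ltz_nat prime_gt0.
apply/hasP; exists `|z|%N.
  by rewrite mem_iota; lia.
have zE : (`|z|%N)%:R = z%:Q :> rat by rewrite -[in RHS](gez0_abs z0).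
pose q := (numq a * v %/ p%:Z)%Z.
pose w := numq a * u + q * denq a.
have E : numq a - z * denq a = w * p%:Z.
  have dv := divz_eq (numq a * v) p%:Z; rewrite -/z -/q in dv.
  have -> : z = numq a * v - q * p%:Z by rewrite dv; ring.
  rewrite /w -[X in X - _ = _]mulr1 -uv; ring.
clearbody z w.
rewrite /eqmod_pow zE expr1.
have -> : (a - z%:Q) / p%:R = w%:Q / (denq a)%:Q; last exact: Zploc_frac.
have pQ : p%:R != 0 :> rat by rewrite pnatr_eq0 -lt0n prime_gt0.
have dQ : (denq a)%:Q != 0 by rewrite intr_eq0 denq_neq0.
have EQ := congr1 (fun t : int => t%:Q) E; rewrite /= !(rmorphB, rmorphM) /= numqE in EQ.
apply/eqP; rewrite eqr_div //; apply/eqP.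
by rewrite mulrBl EQ.
Qed.

Lemma residueP (p : nat) (a : rat) :
  prime p -> a \in Zploc p ->
  (residue p a < p)%N /\ eqmod_pow p 1 a (residue p a)%:R.
Proof.
move=> pp pa; have h := residue_has pp pa.
have lt : (residue p a < p)%N by move: h; rewrite has_find size_iota.
by split=> //; have := nth_find 0%N h; rewrite -/(residue p a) nth_iota.
Qed.

Lemma residue_uniq (p : nat) (a : rat) (r : nat) :
  prime p -> a \in Zploc p -> (r < p)%N -> eqmod_pow p 1 a r%:R ->
  r = residue p a.
Proof.
move=> pp pa rp er; have [sp es] := residueP pp pa.
move: (residue p a) sp es => s sp; rewrite /eqmod_pow !expr1 in er *.
move=> es.
have p0 : p%:R != 0 :> rat by rewrite pnatr_eq0 -lt0n prime_gt0.
move: er es; rewrite !inE; set x := (_ / _); set y := (_ / _) => ex ey.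
have xy : x = (numq x)%:Q / (denq x)%:Q by rewrite divq_num_den.
have yy : y = (numq y)%:Q / (denq y)%:Q by rewrite divq_num_den.
have dx : (denq x)%:Q != 0 by rewrite intr_eq0 denq_neq0.
have dy : (denq y)%:Q != 0 by rewrite intr_eq0 denq_neq0.
have e : (s%:Z - r%:Z) * (denq x * denq y)
       = (numq x * denq y - numq y * denq x) * p%:Z.
  apply: (@intr_inj rat); rewrite !(rmorphB, rmorphM) /= !numqE.
  have -> : s%:~R - r%:~R = (x - y) * p%:R :> rat.
    by rewrite /x /y -mulrBl divfK //; ring.
  by ring.
have : (p%:Z %| (s%:Z - r%:Z) * (denq x * denq y))%Z by rewrite e dvdz_mull.
have cx : coprimez p%:Z (denq x) by rewrite coprimezE prime_coprime.
have cy : coprimez p%:Z (denq y) by rewrite coprimezE prime_coprime.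
rewrite Gauss_dvdzl ?coprimezMr ?cx //.
rewrite -eqz_mod_dvd => /eqP; rewrite !modz_nat !modn_small // => -[].
by [].
Qed.

(* Main.v *)
Require Import Defs.
From mathcomp Require Import all_boot all_order all_algebra.
From mathcomp Require Import ring zify.

Import Order.TTheory GRing.Theory Num.Theory.
Local Open Scope ring_scope.

(* Writing t_k(a) for the k-th term of S_n(a), Zeilberger's method gives constants
   A, B with  k^2 t_k(a) - A t_k(a) - B t_k(a+1) = G(k+1) - G(k), where
     G(k) = -(2/3) (2a^2 + a - 2 + k) k^3 t_k(a) / (a + 1 - k).
   Hence the two sides differ by G(p) and the p^3 term, and it remains to reduce
   G(p) / p^3 modulo p, using  binom(x, p) = (x - <x>_p) / p (mod p)  for
   x = a, -1 - a, 2p.  For p = 3 the factor 1/3 costs one more power of p; there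
   a = 1 + 3a' and the difference is computed exactly as a polynomial in a'. *)

(** * Recurrences of the summand, and the telescoped sum *)

Lemma natS_neq0 (n : nat) : n%:R + 1 != 0 :> rat.
Proof. by rewrite natr1 pnatr_eq0. Qed.

Lemma ratbinS (a : rat) (n : nat) :
  ratbin a n.+1 = ratbin a n * (a - n%:R) / (n%:R + 1).
Proof.
rewrite /ratbin big_ord_recr /= factS natrM -natr1.
have n0 := natS_neq0 n; have f0 : n`!%:R != 0 :> rat by rewrite pnatr_eq0 -lt0n fact_gt0.
by field; rewrite f0 n0.
Qed.

Lemma ratbin_addS (a : rat) (n : nat) :
  ratbin (a + 1) n.+1 = (a + 1) / (n%:R + 1) * ratbin a n.
Proof.
rewrite /ratbin big_ord_recl /= subr0 factS natrM -natr1.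
under eq_bigr => i _ do rewrite /bump /= natrD opprD addrA addrK.
have n0 := natS_neq0 n; have f0 : n`!%:R != 0 :> rat by rewrite pnatr_eq0 -lt0n fact_gt0.
by field; rewrite f0 n0.
Qed.

Lemma central_binS (n : nat) :
  'C(n.+1.*2, n.+1)%:R = 2 * (2 * n%:R + 1) / (n%:R + 1) * 'C(n.*2, n)%:R :> rat.
Proof.
(* Absorption is used twice, to go from row [2n+2] to [2n+1] and from [2n+1] to [2n]; the symmetry
   [e3] of the odd row links the two. *)
have e1 := mul_bin_diag n.+1.*2 n; have e2 := mul_bin_diag n.*2.+1 n.
have e3 : 'C(n.*2.+1, n.+1) = 'C(n.*2.+1, n).
  by rewrite -bin_sub; [congr 'C(_, _) |]; lia.
rewrite doubleS /= -e3 in e1 e2 *.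
have {}e1 := congr1 (fun m : nat => m%:R : rat) e1.
have {}e2 := congr1 (fun m : nat => m%:R : rat) e2.
rewrite !natrM -!natr1 -muln2 natrM in e1 e2; rewrite -muln2.
have n0 := natS_neq0 n.
apply: (mulfI n0); rewrite -e1; apply: (mulfI n0).
rewrite mulrCA -e2; by field.
Qed.

Definition Sterm (a : rat) (n : nat) : rat :=
  ratbin a n * ratbin (-1 - a) n * 'C(n.*2, n)%:R / 4 ^+ n.

Lemma StermS (a : rat) (n : nat) :
  Sterm a n.+1 = Sterm a n * (a - n%:R) * (-1 - a - n%:R) * (2 * n%:R + 1)
                 / (2 * (n%:R + 1) ^+ 3).
Proof.
rewrite /Sterm !ratbinS central_binS exprS.
have n0 := natS_neq0 n; have f0 : 4 ^+ n != 0 :> rat by rewrite expf_neq0.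
by field; rewrite f0 n0.
Qed.

(** Pairing index [n+1] at [a + 1] with index [n] at [a] keeps the ratio free of denominators in
    [a], so no value of [a] is excluded. *)
Lemma Sterm_addS (a : rat) (n : nat) :
  Sterm (a + 1) n.+1 = - Sterm a n * (a + 1 + n%:R) * (a + 2 + n%:R)
                       * (2 * n%:R + 1) / (2 * (n%:R + 1) ^+ 3).
Proof.
rewrite /Sterm ratbin_addS central_binS exprS.
have n0 := natS_neq0 n; have f0 : 4 ^+ n != 0 :> rat by rewrite expf_neq0.
have n1 := natS_neq0 n.+1.
(* The factor [a + 1], supplied by [ratbin_addS] for the first binomial, avoids dividing by [a + 1].
   Both sides come from two expansions of [ratbin (-1 - a) n.+2]. *)
have e : (a + 1) * ratbin (-1 - (a + 1)) n.+1
         = (a + 2 + n%:R) * ratbin (-1 - a) n.+1.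
  have := ratbin_addS (-1 - (a + 1)) n.+1; rewrite ratbinS.
  have -> : -1 - (a + 1) + 1 = -1 - a by ring.
  move/(congr1 (fun z => - (z * (n.+1%:R + 1)))); rewrite divfK // => e.
  have -> : (a + 1) * ratbin (-1 - (a + 1)) n.+1 =
     - ((-1 - a) / (n.+1%:R + 1) * ratbin (-1 - (a + 1)) n.+1 * (n.+1%:R + 1)).
    by move: (n.+1%:R + 1) n1 => u u0; field.
  by rewrite -e -natr1; ring.
rewrite [ratbin (-1 - a) _]ratbinS in e.
have -> : (a + 1) / (n%:R + 1) * ratbin a n * ratbin (-1 - (a + 1)) n.+1
  = ratbin a n * ((a + 1) * ratbin (-1 - (a + 1)) n.+1) / (n%:R + 1) by field.
by rewrite e; field; rewrite f0 n0.
Qed.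

(* The right-hand side is G(n+1) with the division by a - n cancelled, so that it
   stays valid when a = n. *)
Lemma sum_Sterm_telescope (a : rat) (n : nat) :
  \sum_(k < n.+1)
     (k%:R ^+ 2 * Sterm a k - 2 / 3 * a ^+ 2 * (a + 1) ^+ 2 * Sterm a k
      + (2 * a * (a + 1) - 1) / 3 * (a + 1) ^+ 2 * Sterm (a + 1) k)
  = (2 * a ^+ 2 + a - 1 + n%:R) * (a + 1 + n%:R) * (2 * n%:R + 1) / 3
    * Sterm a n.
Proof.
elim: n => [|n IHn].
  rewrite big_ord1 /Sterm /ratbin !big_ord0 /= !mulr0n; by field.
rewrite big_ord_recr {}IHn /= Sterm_addS StermS -!natr1.
have n0 := natS_neq0 n.
by field.
Qed.

(** The boundary term is put back in the form G(n+1): [Sterm a n.+1] has the factor [a - n], which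
    the hypothesis allows to divide out. *)
Lemma sum_square_Sterm (a : rat) (n : nat) : a + 1 != n.+1%:R ->
  \sum_(k < n.+1)
     ratbin a k * ratbin (-1 - a) k * 'C(k.*2, k)%:R * (k%:R ^+ 2 / 4 ^+ k)
  = 2 / 3 * a ^+ 2 * (a + 1) ^+ 2 * Ssum n.+1 a
    - (2 * a * (a + 1) - 1) / 3 * (a + 1) ^+ 2 * Ssum n.+1 (a + 1)
    - 2 / 3 * (2 * a ^+ 2 + a - 2 + n.+1%:R) * n.+1%:R ^+ 3
      * Sterm a n.+1 / (a + 1 - n.+1%:R).
Proof.
rewrite -subr_eq0 => an; have := sum_Sterm_telescope a n.
rewrite big_split sumrB /= -!mulr_sumr.
rewrite -[\sum_(i < _) Sterm a i]/(Ssum n.+1 a).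
rewrite -[\sum_(i < _) Sterm _ i]/(Ssum n.+1 (a + 1)).
have -> : \sum_(i < n.+1) i%:R ^+ 2 * Sterm a i = \sum_(k < n.+1)
     ratbin a k * ratbin (-1 - a) k * 'C(k.*2, k)%:R * (k%:R ^+ 2 / 4 ^+ k).
  by apply: eq_bigr => i _; rewrite /Sterm; ring.
set T := \sum_(k < _) _ => e.
have -> : T = 2 / 3 * a ^+ 2 * (a + 1) ^+ 2 * Ssum n.+1 a
    - (2 * a * (a + 1) - 1) / 3 * (a + 1) ^+ 2 * Ssum n.+1 (a + 1)
    + (T - 2 / 3 * a ^+ 2 * (a + 1) ^+ 2 * Ssum n.+1 a
    + (2 * a * (a + 1) - 1) / 3 * (a + 1) ^+ 2 * Ssum n.+1 (a + 1)) by ring.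
rewrite e StermS -natr1; congr (_ + _).
have n0 := natS_neq0 n; rewrite -natr1 in an.
by field; rewrite n0 [1 + _]addrC an.
Qed.

(** * Arithmetic of Z_p and congruence modulo p *)

Lemma Zploc_nat (p n : nat) : prime p -> n%:R \in Zploc p.
Proof.
move=> pp; have -> : n%:R = (n%:Z)%:Q / 1%:Q :> rat by rewrite divr1.
by apply: Zploc_frac; rewrite dvdz1 /=; have := prime_gt1 pp; lia.
Qed.

Lemma Zploc_denq (p : nat) (x : rat) :
  x \in Zploc p -> [/\ ~~ (p%:Z %| denq x)%Z, (denq x)%:Q != 0
                    & x = (numq x)%:Q / (denq x)%:Q].
Proof. by rewrite inE => ->; rewrite intr_eq0 denq_neq0 divq_num_den. Qed.

Lemma prime_dvdzM (p : nat) (m n : int) : prime p ->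
  (p%:Z %| m * n)%Z = (p%:Z %| m)%Z || (p%:Z %| n)%Z.
Proof. by move=> pp; rewrite !dvdzE abszM Euclid_dvdM. Qed.

Lemma Zploc_add (p : nat) (x y : rat) : prime p ->
  x \in Zploc p -> y \in Zploc p -> x + y \in Zploc p.
Proof.
move=> pp /Zploc_denq[px x0 ex] /Zploc_denq[py y0 ey].
have -> : x + y = (numq x * denq y + numq y * denq x)%:Q / (denq x * denq y)%:Q.
  rewrite !(rmorphD, rmorphM) /= {1}ex {1}ey; field; by rewrite x0 y0.
by apply: Zploc_frac; rewrite prime_dvdzM // negb_or px.
Qed.

Lemma Zploc_mul (p : nat) (x y : rat) : prime p ->
  x \in Zploc p -> y \in Zploc p -> x * y \in Zploc p.
Proof.
move=> pp /Zploc_denq[px x0 ex] /Zploc_denq[py y0 ey].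
have -> : x * y = (numq x * numq y)%:Q / (denq x * denq y)%:Q.
  rewrite !rmorphM /= {1}ex {1}ey; field; by rewrite x0 y0.
by apply: Zploc_frac; rewrite prime_dvdzM // negb_or px.
Qed.

Lemma Zploc_opp (p : nat) (x : rat) : x \in Zploc p -> - x \in Zploc p.
Proof. by rewrite !inE denqN. Qed.

Lemma Zploc_sub (p : nat) (x y : rat) : prime p ->
  x \in Zploc p -> y \in Zploc p -> x - y \in Zploc p.
Proof. by move=> pp px py; rewrite Zploc_add ?Zploc_opp. Qed.

Lemma Zploc_exp (p : nat) (x : rat) (n : nat) : prime p ->
  x \in Zploc p -> x ^+ n \in Zploc p.
Proof.
move=> pp px; elim: n => [|n IHn]; first exact: (Zploc_nat _ 1).
by rewrite exprS Zploc_mul.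
Qed.

Lemma Zploc_natV (p n : nat) : ~~ (p %| n)%N -> n%:R^-1 \in Zploc p.
Proof.
move=> pn; have -> : n%:R^-1 = 1%:Q / (n%:Z)%:Q :> rat by rewrite mul1r.
by apply: Zploc_frac; rewrite dvdzE.
Qed.

Lemma Zploc_inv (p : nat) (x : rat) : prime p ->
  x \in Zploc p -> ~~ eqmod_pow p 1 x 0 -> x^-1 \in Zploc p.
Proof.
move=> pp /Zploc_denq[px x0 ex] nx.
rewrite ex invf_div; apply: Zploc_frac; apply: contra nx => /dvdzP[z ez].
rewrite /eqmod_pow subr0 expr1 ex ez rmorphM /=.
suff -> : z%:Q * p%:Q / (denq x)%:Q / p%:R = z%:Q / (denq x)%:Q by exact: Zploc_frac.
by rewrite mulrAC mulfK // pnatr_eq0 -lt0n prime_gt0.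
Qed.

(** Integrality of both sides is bundled in, since congruences may be multiplied only between
    p-integral numbers. *)
Definition congp (p : nat) (x y : rat) : Prop :=
  [/\ x \in Zploc p, y \in Zploc p & (x - y) / p%:R \in Zploc p].

Lemma congp_refl (p : nat) (x : rat) : prime p -> x \in Zploc p -> congp p x x.
Proof. by move=> pp px; split=> //; rewrite subrr mul0r (Zploc_nat _ 0). Qed.

Lemma congp_add (p : nat) (x y z t : rat) : prime p ->
  congp p x y -> congp p z t -> congp p (x + z) (y + t).
Proof.
move=> pp [px py pxy] [pz pt pzt]; split; [exact: Zploc_add | exact: Zploc_add |].
have -> : x + z - (y + t) = (x - y) + (z - t) by ring.
by rewrite mulrDl; exact: Zploc_add.
Qed.

Lemma congp_mul (p : nat) (x y z t : rat) : prime p ->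
  congp p x y -> congp p z t -> congp p (x * z) (y * t).
Proof.
move=> pp [px py pxy] [pz pt pzt]; split; [exact: Zploc_mul | exact: Zploc_mul |].
have -> : (x * z - y * t) / p%:R = (x - y) / p%:R * z + y * ((z - t) / p%:R) by ring.
by apply: Zploc_add => //; apply: Zploc_mul.
Qed.

Lemma congp_prod (p : nat) (I : finType) (F G : I -> rat) : prime p ->
  (forall i, congp p (F i) (G i)) ->
  congp p (\prod_i F i) (\prod_i G i).
Proof.
move=> pp FG; elim/big_ind2: _ => // [|x y z t]; last exact: congp_mul.
by apply: congp_refl => //; exact: (Zploc_nat _ 1).
Qed.

Lemma Zploc_pV (p : nat) : prime p -> p%:R^-1 \notin Zploc p.
Proof.
move=> pp; apply/negP => /Zploc_denq[pd d0 e].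
have p0 : p%:R != 0 :> rat by rewrite pnatr_eq0 -lt0n prime_gt0.
case/negP: pd; apply/dvdzP; exists (numq p%:R^-1).
by apply: (@intr_inj rat); rewrite rmorphM /= [in RHS]numqE mulrAC mulVf ?mul1r.
Qed.

Lemma congp_inv (p : nat) (x y : rat) : prime p -> y != 0 -> y^-1 \in Zploc p ->
  congp p x y -> x != 0 /\ congp p x^-1 y^-1.
Proof.
move=> pp y0 pyV [px py pxy].
have xp : ~~ eqmod_pow p 1 x 0.
  rewrite /eqmod_pow subr0 expr1; apply: contra (Zploc_pV _ pp) => xp.
  (* If p divided x, it would divide the unit y, and 1/p would be p-integral. *)
  have -> : p%:R^-1 = y^-1 * (x / p%:R - (x - y) / p%:R).
    by move: (p%:R^-1) => u; field.
  by rewrite Zploc_mul ?Zploc_sub.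
have x0 : x != 0.
  by apply: contra xp => /eqP->; rewrite /eqmod_pow subrr mul0r (Zploc_nat _ 0).
have pxV := Zploc_inv _ _ pp px xp.
split=> //; split=> //.
have -> : (x^-1 - y^-1) / p%:R = - (x^-1 * y^-1 * ((x - y) / p%:R)).
  by move: (p%:R^-1) => u; field; rewrite x0 y0.
by apply: Zploc_opp; apply: Zploc_mul => //; apply: Zploc_mul.
Qed.

(** * Binomials with lower index p, modulo p *)

Lemma Zploc_residue (p : nat) (x : rat) : prime p -> x \in Zploc p ->
  (x - (residue p x)%:R) / p%:R \in Zploc p.
Proof. by move=> pp px; have [_] := residueP pp px; rewrite /eqmod_pow expr1. Qed.

Lemma congp_residue (p : nat) (x : rat) : prime p -> x \in Zploc p ->
  congp p x (residue p x)%:R.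
Proof. by move=> pp px; split=> //; [exact: Zploc_nat | exact: Zploc_residue]. Qed.

(** With r the residue of x, the factor x - r absorbs the p of p! = p (p-1)!. The factors before it
    are congruent to r, ..., 1 and those after it to p-1, ..., r+1, so their product cancels (p-1)!
    modulo p. *)
Lemma ratbin_prime (p : nat) (x : rat) : prime p -> x \in Zploc p ->
  congp p (ratbin x p) ((x - (residue p x)%:R) / p%:R).
Proof.
move=> pp px; have [rp _] := residueP pp px.
have cx := congp_residue _ _ pp px; have px' := Zploc_residue _ _ pp px.
have p0 : p%:R != 0 :> rat by rewrite pnatr_eq0 -lt0n prime_gt0.
move: (residue p x) rp cx px' => r rp cx px'.
(* [m] counts the factors after index r. *)
pose m := (p.-1 - r)%N; have ep : p = (r + m.+1)%N by rewrite /m; lia.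
pose N : rat := (p.-1)`!%:R.
have N0 : N != 0 by rewrite pnatr_eq0 -lt0n fact_gt0.
have pN : ~~ (p %| (p.-1)`!)%N.
  apply/negP => pd; have := prime_gt0 pp; rewrite -ltn_predL.
  have : (p <= p.-1)%N; last by lia.
  elim: {1 2}p.-1 pd => [|k IHk]; first by rewrite dvdn1 => /eqP p1; rewrite p1 in pp.
  by rewrite factS Euclid_dvdM // => /orP[/dvdn_leq -> // | /IHk /leqW].
have -> : ratbin x p = (x - r%:R) / p%:R
    * ((\prod_(i < r) (x - i%:R)) * \prod_(i < m) (x - (r + i.+1)%:R) * N^-1).
  have -> : ratbin x p = (\prod_(i < p) (x - i%:R)) / (p%:R * N).
    by rewrite /ratbin -natrM; congr (_ / _%:R); case: (p) pp.
  rewrite [in \prod_(_ < p) _]ep big_split_ord big_ord_recl /= addn0.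
  by field; rewrite p0 N0.
rewrite -[X in congp _ _ X]mulr1; apply: congp_mul => //; first exact: congp_refl.
have efact : (r`! * p.-1 ^_ m)%N = (p.-1)`!.
  have mp : (m <= p.-1)%N by rewrite /m leq_subr.
  have rm : (p.-1 - m)%N = r by rewrite /m; lia.
  by have := ffact_fact mp; rewrite rm mulnC.
have e1 : 1 = (\prod_(i < r) (r - i)%:R) * (\prod_(i < m) (p.-1 - i)%:R) * N^-1 :> rat.
  rewrite -!natr_prod -!ffact_prod ffactnn -natrM.
  by rewrite efact divff.
rewrite [X in congp _ _ X]e1.
apply: congp_mul => //; last by apply: congp_refl => //; exact: Zploc_natV.
have pr k : congp p (- k%:R) (- k%:R) by apply: congp_refl => //; apply/Zploc_opp/Zploc_nat.
apply: congp_mul => //.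
  apply: (congp_prod _ _ _ _ pp) => i.
  rewrite natrB; last exact: ltnW.
  exact: congp_add.
apply: (congp_prod _ _ _ _ pp) => i.
have ei : x - (r + i.+1)%:R - (p.-1 - i)%:R = (x - r%:R) - p%:R.
  have im := ltn_ord i; have en : (r + i.+1 + (p.-1 - i) = r + p)%N by lia.
  by rewrite -addrA -opprD -natrD en natrD opprD addrA.
split; [exact/Zploc_sub/Zploc_nat | exact: Zploc_nat | rewrite ei mulrBl divff //].
by apply: Zploc_sub => //; exact: (Zploc_nat _ 1).
Qed.

Lemma congp_nat (p m n : nat) : prime p -> m = n %[mod p] -> congp p m%:R n%:R.
Proof.
move=> pp mn; split; try exact: Zploc_nat.
have p0 : p%:R != 0 :> rat by rewrite pnatr_eq0 -lt0n prime_gt0.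
have -> : (m%:R - n%:R) / p%:R = (m %/ p)%:R - (n %/ p)%:R :> rat.
  rewrite {1}(divn_eq m p) {1}(divn_eq n p) mn !natrD !natrM.
  by field.
by apply: Zploc_sub => //; exact: Zploc_nat.
Qed.

Lemma ratbin_nat (n k : nat) : (k <= n)%N -> ratbin n%:R k = 'C(n, k)%:R.
Proof.
move=> kn; have f0 : k`!%:R != 0 :> rat by rewrite pnatr_eq0 -lt0n fact_gt0.
apply: (mulIf f0); rewrite divfK // -natrM bin_ffact ffact_prod natr_prod.
by apply: eq_bigr => i _; rewrite natrB // ltnW // (leq_trans (ltn_ord i)).
Qed.

Lemma congp_central_bin (p : nat) : prime p -> congp p 'C(p.*2, p)%:R 2.
Proof.
move=> pp; have p0 : p%:R != 0 :> rat by rewrite pnatr_eq0 -lt0n prime_gt0.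
have px : p.*2%:R \in Zploc p by exact: Zploc_nat.
have e : p.*2%:R / p%:R = 2 :> rat by rewrite -mul2n natrM mulfK.
have := ratbin_prime _ _ pp px; rewrite ratbin_nat; last by rewrite -addnn leq_addr.
rewrite -(residue_uniq (r := 0%N) pp px) ?prime_gt0 //; first by rewrite subr0 e.
by rewrite /eqmod_pow subr0 expr1 e; exact: (Zploc_nat _ 2).
Qed.

(** The residue of -1 - a is p - 1 - r, where r is that of a. *)
Lemma residue_N1B (p : nat) (a : rat) : prime p -> a \in Zploc p ->
  (-1 - a - (residue p (-1 - a))%:R) / p%:R
  = - ((a - (residue p a)%:R) / p%:R) - 1.
Proof.
move=> pp pa; have p0 : p%:R != 0 :> rat by rewrite pnatr_eq0 -lt0n prime_gt0.
have [rp _] := residueP pp pa; have pa' := Zploc_residue _ _ pp pa.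
have pb : -1 - a \in Zploc p.
  by apply: Zploc_sub => //; apply: Zploc_opp; exact: (Zploc_nat _ 1).
move: (residue p a) rp pa' => r rp pa'.
have e : (-1 - a - (p.-1 - r)%N%:R) / p%:R = - ((a - r%:R) / p%:R) - 1.
  have -> : (p.-1 - r)%N%:R = p%:R - r%:R - 1 :> rat.
    have /(congr1 (fun n : nat => n%:R : rat)) : (p = p.-1 - r + r + 1)%N by lia.
    by rewrite !natrD => {1}->; ring.
  by field.
rewrite -(residue_uniq (r := (p.-1 - r)%N) pp pb) //; first by lia.
rewrite /eqmod_pow expr1 e.
by apply: Zploc_sub => //; [exact: Zploc_opp | exact: (Zploc_nat _ 1)].
Qed.

(** The factors a', -a' - 1 and 2 come from the three binomials; 1/4 comes from Fermat's 4^p = 4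
    (mod p), with 4 invertible as p is odd. *)
Lemma congp_Sterm (p : nat) (a : rat) (a' := (a - (residue p a)%:R) / p%:R) :
  prime p -> odd p -> a \in Zploc p ->
  congp p (Sterm a p) (a' * (- a' - 1) * 2 / 4).
Proof.
move=> pp po pa; rewrite /Sterm.
have pb : -1 - a \in Zploc p.
  by apply: Zploc_sub => //; apply: Zploc_opp; exact: (Zploc_nat _ 1).
apply: congp_mul => //; last first.
  have [] // := congp_inv p (4 ^+ p) 4 pp.
    apply: Zploc_natV; apply: contraL po.
    by rewrite -[4%N]/(2 ^ 2)%N Euclid_dvdX // dvdn_prime2 // => /andP[/eqP->].
  by rewrite -natrX; apply: congp_nat => //; exact: fermat_little.
apply: congp_mul => //; last exact: congp_central_bin.
rewrite -residue_N1B //.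
by apply: congp_mul => //; exact: ratbin_prime.
Qed.

(** * The case p = 3 and the final reduction *)

Lemma residue3 (a : rat) : a \in Zploc 3 ->
  ~~ eqmod_pow 3 1 a 0 -> ~~ eqmod_pow 3 1 a (-1) -> residue 3 a = 1%N.
Proof.
move=> pa; have p3 : prime 3 by [].
have [] := residueP p3 pa; case: (residue 3 a) => [|[|[|]]] // _ e; first by rewrite e.
move=> _; case/negP; move: e; rewrite /eqmod_pow expr1 => e.
have -> : (a - -1) / 3 = (a - 2) / 3 + 1 by field.
by apply: Zploc_add => //; exact: (Zploc_nat _ 1).
Qed.

(* The goals are matched syntactically before applying a lemma: plain [apply] may
   try to evaluate [denq] on closed numerals. *)
Ltac zploc pp :=
  repeat match goal with
  | H : is_true (?x \in Zploc ?p) |- is_true (?x \in Zploc ?p) => exact H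
  | |- is_true (_ + _ \in Zploc _) => apply: Zploc_add; [exact pp | |]
  | |- is_true (- _ \in Zploc _) => apply: Zploc_opp
  | |- is_true (_ * _ \in Zploc _) => apply: Zploc_mul; [exact pp | |]
  | |- is_true (_ ^+ _ \in Zploc _) => apply: Zploc_exp; [exact pp |]
  | |- is_true (_%:R \in Zploc _) => exact (Zploc_nat _ _ pp)
  | |- is_true (1 \in Zploc _) => exact (Zploc_nat _ 1 pp)
  end.

(* The summand 0 on the right matches q = p, which is 0 modulo p, so that the two
   terms of the difference are congruent factor by factor. *)
Lemma defect_eq (a a' q S t : rat) : a + 1 != 0 -> a + 1 - q != 0 -> q != 0 ->
  (S - 2 / 3 * (2 * a ^+ 2 + a - 2 + q) * q ^+ 3 * t / (a + 1 - q)
   - (S + (2 * a ^+ 2 + a - 2) * a' * (a' + 1) / (3 * (a + 1)) * q ^+ 3)) / q ^+ 4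
  = (2 * (2 * a ^+ 2 + a - 2 + 0) * (a' * (- a' - 1) * 2 / 4) / (a + 1)
     - 2 * (2 * a ^+ 2 + a - 2 + q) * t / (a + 1 - q)) / 3 / q.
Proof. by move=> c0 cq0 q0; field; rewrite q0 c0 cq0. Qed.

(** The constant is binom(6,3) / (4^3 (3!)^2) = 5 / 24^2, and the sign is that of (-1-a)(-2-a)(-3-a)
    = -(a+1)(a+2)(a+3). *)
Lemma Sterm3 (a : rat) :
  Sterm a 3 = - 5 / 24 ^+ 2 * (a * (a - 1) * (a - 2) * (a + 1) * (a + 2) * (a + 3)).
Proof.
have S0 : Sterm a 0 = 1 by rewrite /Sterm /ratbin !big_ord0 mulr1 divff.
by rewrite !StermS S0; field.
Qed.

(* For p = 3 the cancellation of the two denominators 3 uses the exact value of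
   Sterm a 3: the numerator becomes 9 times an integer polynomial in b = a'. *)
Lemma defect3_eq (a b : rat)
    (v := 5 * b * (12 + 28 * b + 27 * b ^+ 2 + 9 * b ^+ 3)) :
  a = 1 + 3 * b -> a + 1 != 0 -> a + 1 - 3 != 0 ->
  (2 * (2 * a ^+ 2 + a - 2 + 0) * (b * (- b - 1) * 2 / 4) / (a + 1)
   - 2 * (2 * a ^+ 2 + a - 2 + 3) * Sterm a 3 / (a + 1 - 3)) / 3 / 3
  = b * (b + 1) * (32 + 4 * v + b * (5 + 6 * b) * (16 + 3 * v)) / 32 / (a + 1).
Proof.
move=> aE; have e1 : a + 1 - 3 = 3 * b - 1 by rewrite aE; ring.
have e2 : a + 1 = 2 + 3 * b by rewrite aE; ring.
move: (Sterm3 a); move: (Sterm a 3) => t; rewrite e1 e2.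
(* Here 5(1+3b)(2+3b)^2(4+3b) = 80 + 9v, and M = 2a^2 + a - 2 = 1 + 3b(5+6b). Over 32(a+1) the
   numerator is b(b+1)((M+3)(80+9v) - 32M), whose last factor is a multiple of 9. *)
move=> tE c0 c3; rewrite tE aE /v.
by field; rewrite c0 c3.
Qed.

Theorem theorem6p2 (p : nat) (a : rat) (p_prime : prime p) (p_odd : odd p)
    (a_Zp : a \in Zploc p)
    (a_neq0 : ~~ eqmod_pow p 1 a 0) (a_neqN1 : ~~ eqmod_pow p 1 a (-1)) :
  let a' : rat := (a - (residue p a)%:R) / p%:R in
  eqmod_pow p 4
    (\sum_(k < p)
       ratbin a k * ratbin (-1 - a) k * 'C(k.*2, k)%:R * (k%:R ^+ 2 / 4 ^+ k))
    (2 / 3 * a ^+ 2 * (a + 1) ^+ 2 * Ssum p a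
     - (2 * a * (a + 1) - 1) / 3 * (a + 1) ^+ 2 * Ssum p (a + 1)
     + (2 * a ^+ 2 + a - 2) * a' * (a' + 1) / (3 * (a + 1)) * p%:R ^+ 3).
Proof.
set a' := (a - (residue p a)%:R) / p%:R; cbv zeta.
have p0 : p%:R != 0 :> rat by rewrite pnatr_eq0 -lt0n prime_gt0.
have Zn n : n%:R \in Zploc p by exact: Zploc_nat.
have a'_Zp : a' \in Zploc p by exact: Zploc_residue.
have c_Zp : a + 1 \in Zploc p by apply: Zploc_add => //; exact: (Zn 1).
have cV_Zp : (a + 1)^-1 \in Zploc p.
  by apply: Zploc_inv => //; move: a_neqN1; rewrite /eqmod_pow subr0 opprK.
have c0 : a + 1 != 0.
  apply: contra a_neqN1 => /eqP c0; rewrite /eqmod_pow opprK c0 mul0r; exact: (Zn 0).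
have p_mod0 : congp p p%:R 0 by apply: (congp_nat _ _ 0); rewrite ?modnn ?mod0n.
(* Modulo p this is the unit [a + 1]; its being nonzero is what [sum_square_Sterm] requires at n = p
   - 1. *)
have [cp0 cpV] : a + 1 - p%:R != 0 /\ congp p (a + 1 - p%:R)^-1 (a + 1)^-1.
  apply: congp_inv => //; split=> //; first exact: Zploc_sub.
  have -> : (a + 1 - p%:R - (a + 1)) / p%:R = -1 by field.
  by apply: Zploc_opp; exact: (Zn 1).
set S : rat := 2 / 3 * a ^+ 2 * (a + 1) ^+ 2 * Ssum p a
     - (2 * a * (a + 1) - 1) / 3 * (a + 1) ^+ 2 * Ssum p (a + 1).
have := sum_square_Sterm a p.-1; rewrite prednK ?prime_gt0 //.
rewrite -subr_eq0 -/S => /(_ cp0) sumE; rewrite /eqmod_pow {}sumE defect_eq //.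
have [p3|np3] := eqVneq p 3%N.
  have r1 : residue p a = 1%N by move: a_Zp a_neq0 a_neqN1; rewrite p3; exact: residue3.
  have aE : a = 1 + 3 * a' by rewrite /a' r1 p3; field.
  have c3 : a + 1 - 3 != 0 by rewrite p3 in cp0.
  rewrite p3 defect3_eq //.
  (* Only the denominators 32 and [a + 1] remain, both units at 3. *)
  have v3 : 32%:R^-1 \in Zploc 3 by apply: Zploc_natV.
  clearbody a'; rewrite p3 in a'_Zp cV_Zp.
  rewrite p3 in p_prime; zploc p_prime.
(* For p other than 3, the factor 1/3 is p-integral, so [x] congruent to [y] modulo p suffices. *)
set x := 2 * (2 * a ^+ 2 + a - 2 + p%:R) * Sterm a p / (a + 1 - p%:R).
set y := 2 * (2 * a ^+ 2 + a - 2 + 0) * (a' * (- a' - 1) * 2 / 4) / (a + 1).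
have cM : congp p (2 * (2 * a ^+ 2 + a - 2 + p%:R)) (2 * (2 * a ^+ 2 + a - 2 + 0)).
  have c2 : congp p 2 2 by apply: (congp_refl _ _ p_prime); exact: Zn.
  have cM0 : congp p (2 * a ^+ 2 + a - 2) (2 * a ^+ 2 + a - 2).
    by apply: (congp_refl _ _ p_prime); zploc p_prime.
  exact: (congp_mul _ _ _ _ _ p_prime c2 (congp_add _ _ _ _ _ p_prime cM0 p_mod0)).
have xy : congp p x y.
  have ct := congp_Sterm _ _ p_prime p_odd a_Zp.
  exact: (congp_mul _ _ _ _ _ p_prime (congp_mul _ _ _ _ _ p_prime cM ct) cpV).
case: xy => _ _ /Zploc_opp; rewrite -mulNr opprB => xy; clearbody x y.
rewrite mulrAC; apply: Zploc_mul => //.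
by apply: Zploc_natV; rewrite dvdn_prime2.
Qed.
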